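(* Let $n \ge 1$, let $0 < \varepsilon \le 1/2$, and consider the single-processor cup game on $n$ cups with parameter $\varepsilon$ in which the emptier uses the smoothed greedy algorithm against an oblivious filler. There exist absolute constants $C, c > 0$ (independent of $n$, $\varepsilon$, the step, and the filler) such that for every oblivious filler, every step $i \in \mathbb{N}$, and every real $k \ge 0$ with $3 \log \frac{1}{\varepsilon} \le k$, the probability that the backlog after step $i$ is $k$ or greater is at most $C \cdot 2^{-2^{ck}}$.
   Context: Single-processor cup game with parameter $\varepsilon$: there are $n$ cups, initially empty. In each step $i$, the filler first pours nonnegative amounts $c_j(i)$ of water into the cups $j \in [n]$ with $\sum_j c_j(i) \le 1-\varepsilon$; then the emptier may select one cup and remove up to one unit of water from it. The filler is oblivious: the amounts $c_j(i)$ for all steps are fixed in advance and do not depend on the emptier's random choices. Smoothed greedy algorithm: at the start of the game the emptier draws independent uniformly random $r_1,\dots,r_n \in (0,1]$ and places $r_j$ units of water in cup $j$; at the end of each step, if every cup contains less than one unit of water the emptier does nothing, and otherwise it removes exactly one unit of water from a fullest cup. Let $f_j(i)$ be the amount of water in cup $j$ after step $i$ (including the inserted $r_j$); the backlog after step $i$ is $\max_j f_j(i)$. *)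

(* Defs.v *)
From HB Require Import structures.
From mathcomp Require Import all_boot all_order all_algebra.
From mathcomp Require Import all_classical all_reals all_analysis.

Set Implicit Arguments.
Unset Strict Implicit.
Unset Printing Implicit Defensive.

Import Order.TTheory GRing.Theory Num.Theory.
Import numFieldNormedType.Exports.

Local Open Scope classical_set_scope.
Local Open Scope ring_scope.

Definition uniform_01 (R : realType) (d : measure_display)
    (T : measurableType d) (P : probability T R) (X : {RV P >-> R}) : Prop :=
  (forall w, 0 < X w <= 1) /\
  (forall A : set (measurableTypeR R), measurable A ->
     distribution P X A = uniform_prob (@ltr01 R) A).

Definition mutually_independent (R : realType) (d : measure_display)
    (T : measurableType d) (P : probability T R) (n : nat)
    (X : 'I_n -> {RV P >-> R}) : Prop :=
  forall (J : {set 'I_n}) (A : 'I_n -> set (measurableTypeR R)),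
    (forall j, measurable (A j)) ->
    P [set w | forall j, j \in J -> A j (X j w)] =
      (\prod_(j in J) P (X j @^-1` A j))%E.

(* Steps are numbered from 1, so c 0 is never used. A filler is a fixed
   sequence, not a function of the sample point: this is obliviousness. *)
Definition oblivious_filler (R : realType) (n : nat) (eps : R)
    (c : nat -> 'I_n -> R) : Prop :=
  forall i, (0 < i)%N ->
    (forall j, 0 <= c i j) /\ \sum_(j < n) c i j <= 1 - eps.

(* [greedy_empties g f]: the emptier's move may turn the fills g (after the
   filler has poured) into f. It is a relation because ties between fullest
   cups may be broken in any way. *)
Definition greedy_empties (R : realType) (n : nat) (g f : 'I_n -> R) : Prop :=
  if [forall j, g j < 1] then forall j, f j = g j
  else exists2 m : 'I_n, (forall j, g j <= g m) &
         forall j, f j = if j == m then g j - 1 else g j.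

(* f i j is the (random) fill of cup j after step i, f 0 j being the initial
   fill r_j. The rules of the game hold at every sample point; nothing is
   assumed on how ties depend on the history or on the sample point, except
   that the resulting fills are random variables. *)
Definition smoothed_greedy_game (R : realType) (d : measure_display)
    (T : measurableType d) (P : probability T R) (n : nat)
    (c : nat -> 'I_n -> R) (f : nat -> 'I_n -> {RV P >-> R}) : Prop :=
  [/\ forall j, uniform_01 (f 0%N j),
      mutually_independent (f 0%N) &
      forall i w, greedy_empties (fun j => f i j w + c i.+1 j)
                                 (fun j => f i.+1 j w)].

(* Fills are nonnegative, so the base value 0 does not affect the maximum. *)
Definition backlog (R : realType) (n : nat) (f : 'I_n -> R) : R :=
  \big[Num.max/0]_(j < n) f j.

(* Main.v *)
(** Greedy always removes whole units, so the fractional part of a fill is that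
    of [r_j] plus the water poured so far, and the number of integer thresholds
    that cup [j] crosses in a window of steps is a constant plus a Bernoulli
    variable, whose mean sums to the amount poured, independently over [j].
    Deterministically, the integer parts of the fills form a queue served at
    rate one, and the classical averaging argument over the fullest cups,
    strengthened by the slack [eps] lost in every step, shows that a fill above
    [1 + H_m] at time [i] forces this queue to exceed [m + eps (i - s)] at some
    time [s <= i]. A Chernoff bound for every window and a union bound then give
    probability [O(eps^-4 exp (- eps m / 2))], and [m] close to [exp (k / 2)]
    has both [1 + H_m < k] and [eps m >= exp (k / 6) / 2]. *)

Require Import Defs.
From HB Require Import structures.
From mathcomp Require Import all_boot all_order all_algebra.
From mathcomp Require Import all_classical all_reals all_analysis.
From mathcomp Require Import zify ring lra.

Set Implicit Arguments.
Unset Strict Implicit.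
Unset Printing Implicit Defensive.

Import Order.TTheory GRing.Theory Num.Theory.
Import numFieldNormedType.Exports.

Local Open Scope classical_set_scope.
Local Open Scope ring_scope.

(** * Poured water, threshold crossings and the greedy step *)

Definition poured (R : realType) (n : nat) (pour : nat -> 'I_n -> R)
    (i : nat) (j : 'I_n) : R :=
  \sum_(s < i) pour s.+1 j.

Lemma pouredS (R : realType) (n : nat) (pour : nat -> 'I_n -> R) i j :
  poured pour i.+1 j = poured pour i j + pour i.+1 j.
Proof. by rewrite /poured big_ord_recr. Qed.

(* The number of integers in the closed interval from [r + x] to [r + y]. It is
   closed on the left so that a cup starting with r = 1 has a crossing. *)
Definition crossings (R : realType) (x y r : R) : int :=
  Num.floor (r + y) - (Num.ceil (r + x) - 1).

Lemma crossings_refl_ge0 (R : realType) (x r : R) : 0 <= crossings x x r.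
Proof.
rewrite /crossings subr_ge0 floor_ge_int.
by have /andP[/ltW] := ceil_itv (r + x).
Qed.

(** In the busy case the removal is written as an indicator, so that a sum over cups visibly drops
    by exactly one. *)
Lemma greedy_emptiesP (R : realType) (n : nat) (g f : 'I_n -> R) :
  greedy_empties g f ->
  (forall j, g j < 1 /\ f j = g j) \/
  exists m, [/\ forall j, g j <= g m, 1 <= g m &
                forall j, f j = g j - (j == m)%:R].
Proof.
rewrite /greedy_empties; case: ifPn => [/forallP g1 fg|].
  by left=> j; split; [exact: g1 | exact: fg].
rewrite negb_forall => /existsP[j0]; rewrite -leNgt => g1 [m gm fg].
right; exists m; split=> [//||j]; first exact: le_trans g1 (gm j0).
by rewrite fg; case: eqP => //=; rewrite subr0.
Qed.

Lemma floorB1 (R : realType) (x : R) : Num.floor (x - 1) = Num.floor x - 1.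
Proof. by rewrite -(mulrN1z 1) floorDrz ?intr_int// intrKfloor. Qed.

(** * Harmonic sums *)

Definition harmonic_sum (R : realType) (m : nat) : R := \sum_(i < m) i.+1%:R^-1.

Lemma harmonic_sumS (R : realType) m :
  harmonic_sum R m.+1 = harmonic_sum R m + m.+1%:R^-1.
Proof. by rewrite /harmonic_sum big_ord_recr. Qed.

Lemma le_harmonic_sum (R : realType) :
  {homo harmonic_sum R : a b / (a <= b)%N >-> a <= b}.
Proof.
move=> a b /subnKC <-; elim: (b - a)%N => [|d IH]; first by rewrite addn0.
by rewrite addnS harmonic_sumS (le_trans IH)// lerDl invr_ge0.
Qed.

Lemma harmonic_sum_le_ln (R : realType) m :
  (0 < m)%N -> harmonic_sum R m <= 1 + ln m%:R.
Proof.
case: m => // m _; elim: m => [|m IH].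
  by rewrite /harmonic_sum big_ord_recr big_ord0/= ln1 invr1 addr0 add0r.
rewrite harmonic_sumS -lerBrDr (le_trans IH)// -addrA lerD2l lerBrDr -lerBrDl.
have m2 : (0 : R) < m.+2%:R by [].
have m1 : (0 : R) < m.+1%:R by [].
(* The increment [1 / (m + 2)] is at most [ln ((m + 2) / (m + 1))], by [ln (1 + u) <= u] at
   [u = - 1 / (m + 2)]. *)
rewrite -lerN2 opprB -ln_div ?posrE//.
have -> : (m.+1%:R / m.+2%:R : R) = 1 + - m.+2%:R^-1.
  by rewrite -[m.+2%:R]natr1; field; move: (ler0n R m) => ?; apply/eqP => ?; lra.
apply: le_ln1Dx; rewrite ltrN2 invf_lt1 ?ltr1n//.
Qed.

(** * Deterministic analysis of one trajectory *)

Section Trajectory.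
Context (R : realType) (n : nat) (eps : R).
Context (pour f : nat -> 'I_n -> R).
Hypothesis eps_gt0 : 0 < eps.
Hypothesis fillerP : oblivious_filler eps pour.
Hypothesis f0P : forall j, 0 < f 0%N j <= 1.
Hypothesis stepP : forall i,
  greedy_empties (fun j => f i j + pour i.+1 j) (f i.+1).

Let pour_ge0 i j : 0 <= pour i.+1 j.
Proof. by have [] := fillerP (ltn0Sn i). Qed.

Lemma fill_ge0 i j : 0 <= f i j.
Proof.
elim: i j => [|i IH] j; first by have /andP[/ltW] := f0P j.
case: (greedy_emptiesP (stepP i)) => [/(_ j) [_ ->]|[m [_ gm ->]]].
  by rewrite addr_ge0.
case: eqP => [->|_]; first by rewrite subr_ge0.
by rewrite subr0 addr_ge0.
Qed.

Lemma removed_int i j : f 0%N j + poured pour i j - f i j \is a Num.int.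
Proof.
elim: i j => [|i IH] j; first by rewrite /poured big_ord0 addr0 subrr.
rewrite pouredS.
case: (greedy_emptiesP (stepP i)) => [/(_ j) [_ ->]|[m [_ _ ->]]].
  by rewrite (_ : _ - _ = f 0%N j + poured pour i j - f i j) //; ring.
rewrite (_ : _ - _ = f 0%N j + poured pour i j - f i j + (j == m)%:R); last ring.
by rewrite rpredD// natr_int.
Qed.

(** Only whole units are ever removed, so pouring crosses the same number of integers as in a cup
    that is never emptied. That number depends on the initial fill and the filler alone, not on the
    emptier's choices. *)
Lemma floor_pour i j :
  Num.floor (f i j + pour i.+1 j) =
  Num.floor (f i j) + (Num.floor (f 0%N j + poured pour i.+1 j)
                       - Num.floor (f 0%N j + poured pour i j)).
Proof.
have := removed_int i j; set d := _ - f i j => dint.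
rewrite pouredS (_ : f 0%N j + _ = f i j + pour i.+1 j + d); last first.
  by rewrite /d; ring.
rewrite (_ : f 0%N j + _ = f i j + d); last by rewrite /d; ring.
by rewrite !(floorDrz _ dint); ring.
Qed.

(* t is the last time before s at which all cups held less than one unit *)
Lemma queue_bound s : exists2 t, (t <= s)%N &
  \sum_j Num.floor (f s j) <=
  \sum_j crossings (poured pour t j) (poured pour s j) (f 0%N j) - (s - t)%:Z.
Proof.
elim: s => [|s [t ts IH]].
  (* An initial fill in [(0, 1]] has ceiling 1, so the crossings of the empty window at time 0 equal
     its floor, even when the fill is 1. *)
  exists 0%N => //; rewrite subr0; apply: ler_sum => j _.
  rewrite /crossings /poured big_ord0 addr0.
  suff -> : Num.ceil (f 0%N j) = 1 by rewrite !subrr subr0.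
  by apply: ceil_def; rewrite subrr.
case: (greedy_emptiesP (stepP s)) => [small|[m [_ gm fE]]].
  exists s.+1 => //; rewrite subnn subr0; apply: ler_sum => j _.
  apply: le_trans (crossings_refl_ge0 _ _).
  by rewrite floor_le0; have [? ->] := small j.
(* In a busy step the new crossings enter the queue, one unit leaves it, and the window grows by one
   step. *)
exists t; first exact: leqW.
rewrite subSn//.
have -> : \sum_j Num.floor (f s.+1 j) =
  \sum_j Num.floor (f s j) + \sum_j (Num.floor (f 0%N j + poured pour s.+1 j)
                       - Num.floor (f 0%N j + poured pour s j)) - 1.
  rewrite -big_split/= (_ : 1 = \sum_j (j == m)%:Z); last first.
    by rewrite (bigD1 m)//= eqxx big1 ?addr0// => j /negbTE ->.
  rewrite -sumrB; apply: eq_bigr => j _.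
  rewrite -floor_pour fE; case: eqP => _; last by rewrite !subr0.
  exact: floorB1.
have -> : \sum_j crossings (poured pour t j) (poured pour s.+1 j) (f 0%N j) =
  \sum_j crossings (poured pour t j) (poured pour s j) (f 0%N j) +
  \sum_j (Num.floor (f 0%N j + poured pour s.+1 j)
                       - Num.floor (f 0%N j + poured pour s j)).
  by rewrite -big_split/=; apply: eq_bigr => j _; rewrite /crossings; ring.
move: IH; clear; lia.
Qed.

(** * Averages over the fullest cups *)

Section TopFills.
Context (i m : nat).
Hypothesis m_gt0 : (0 < m)%N.
(** The allowance grows with the distance to time [i]; this makes the probabilities of violating it
    summable over [s]. *)
Hypothesis queue_small : forall s, (s <= i)%N ->
  (\sum_j Num.floor (f s j))%:~R <= m%:R + eps * (i - s)%:R.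

(* If the emptied cup is outside A, it is at least as full as every cup of A,
   so the average over A is at most the average over A and that cup. *)
Lemma top_fills s (A : {set 'I_n}) : (s <= i)%N -> (0 < #|A| <= m)%N ->
  \sum_(j in A) f s j <=
  #|A|%:R * (2 + (harmonic_sum R m - harmonic_sum R #|A|) + eps / m%:R * (i - s)%:R).
Proof.
have small1 s' (B : {set 'I_n}) : (0 < #|B| <= m)%N -> (forall j, f s' j <= 1) ->
  \sum_(j in B) f s' j <=
  #|B|%:R * (2 + (harmonic_sum R m - harmonic_sum R #|B|) + eps / m%:R * (i - s')%:R).
  move=> /andP[_ Bm] f1.
  apply: (@le_trans _ _ (\sum_(j in B) 1)); first exact: ler_sum.
  rewrite sumr_const ler_peMr// -addrA.
  have := le_harmonic_sum R Bm.
  have : 0 <= eps / m%:R * (i - s')%:R by rewrite mulr_ge0// divr_ge0// ltW.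
  lra.
elim: s A => [|s IH] A si Am.
  by apply: small1 => // j; have /andP[] := f0P j.
case: (greedy_emptiesP (stepP s)) => [small|[e [e_max e1 fE]]].
  by apply: small1 => // j; have [/ltW ? ->] := small j.
have [fge0 fsum] := fillerP (ltn0Sn s).
have [A_gt0 Am'] := andP Am.
have mR : (0 : R) < m%:R by rewrite ltr0n.
have AR : (0 : R) < #|A|%:R by rewrite ltr0n.
have iS : (i - s)%:R = (i - s.+1)%:R + 1 :> R.
  by rewrite natr1 subnSK.
have sum_pour (B : {set 'I_n}) : \sum_(j in B) pour s.+1 j <= 1 - eps.
  apply: le_trans fsum; rewrite [leRHS](bigID (mem B))/= lerDl.
  by apply: sumr_ge0 => j _.
have [eA|eA] := boolP (e \in A).
  have -> : \sum_(j in A) f s.+1 j = \sum_(j in A) f s j + \sum_(j in A) pour s.+1 j - 1.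
    rewrite -big_split/= (_ : 1 = \sum_(j in A) (j == e)%:R).
      by rewrite -sumrB; apply: eq_bigr => j _; rewrite fE.
    by rewrite (bigD1 e)//= eqxx big1 ?addr0// => j /andP[_ /negbTE ->].
  (* At most [1 - eps] enters [A] and one unit leaves it. The net loss [eps] covers the drop
     [a * eps / m] of the bound, as [a <= m]. *)
  have := IH A (ltnW si) Am; have := sum_pour A; rewrite iS.
  set a := #|A|%:R in AR *.
  have : a * (eps / m%:R) <= eps.
    by rewrite mulrCA (ler_piMr (ltW eps_gt0))// ler_pdivrMr// mul1r ler_nat.
  lra.
have fA : \sum_(j in A) f s.+1 j = \sum_(j in A) (f s j + pour s.+1 j).
  apply: eq_bigr => j jA; rewrite fE; case: eqP => [je|_]; last by rewrite subr0.
  by rewrite je (negbTE eA) in jA.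
move: Am'; rewrite leq_eqVlt => /predU1P[Aeq|Alt].
  have q := queue_small si.
  (* For [#|A| = m] the harmonic terms cancel: each fill is at most 1 plus its floor, and the queue
     bound on the floors gives [2 m + eps (i - s)] in all. *)
  have : \sum_(j in A) f s.+1 j <= #|A|%:R + (\sum_j Num.floor (f s.+1 j))%:~R.
    apply: (@le_trans _ _ (\sum_(j in A) (1 + (Num.floor (f s.+1 j))%:~R))).
      apply: ler_sum => j _; have := floorD1_gt (f s.+1 j).
      by rewrite rmorphD/= addrC => /ltW.
    rewrite big_split/= sumr_const lerD2l rmorph_sum/=.
    rewrite [leRHS](bigID (mem A))/= lerDl sumr_ge0// => j _.
    by rewrite ler0z floor_ge0 fill_ge0.
  move=> h; apply: (le_trans h); rewrite Aeq subrr addr0 mulrDr.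
  have -> : m%:R * (eps / m%:R * (i - s.+1)%:R) = eps * (i - s.+1)%:R.
    by field; rewrite gt_eqF.
  lra.
set a := (#|A|%:R : R) in AR *.
have AeE : #|e |: A| = #|A|.+1 by rewrite cardsU1 eA.
have := IH (e |: A) (ltnW si); rewrite AeE Alt => /(_ isT).
rewrite big_setU1//= iS harmonic_sumS -[#|A|.+1%:R]natr1 -/a => h.
have := sum_pour (e |: A); rewrite big_setU1//= => hp.
rewrite fA.
have avg : \sum_(j in A) (f s j + pour s.+1 j) <= a * (f s e + pour s.+1 e).
  by rewrite /a mulr_natl -sumr_const; apply: ler_sum => j _; exact: e_max.
move: avg; rewrite big_split/= => avg.
set F := \sum_(j in A) f s j in h avg *; set G := \sum_(j in A) _ in hp avg *.
set H := harmonic_sum R #|A| in h *.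
set K := harmonic_sum R m in h *.
set x := (i - s.+1)%:R in h *.
have a1 : 0 < a + 1 by rewrite addr_gt0.
have dm : (a + 1) * (eps / m%:R) <= eps.
  by rewrite mulrCA (ler_piMr (ltW eps_gt0))// ler_pdivrMr// mul1r natr1 ler_nat.
set d := eps / m%:R in h dm *.
(* After averaging, the harmonic term [(a + 1)^-1] contributes [-1], which together with
   [(a + 1) * d <= eps] absorbs the inflow [1 - eps]. *)
have : (a + 1) * (F + G) <= a * ((a + 1) *
    (2 + (K - (H + (a + 1)^-1)) + d * (x + 1)) + (1 - eps)).
  apply: (@le_trans _ _ (a * ((f s e + F) + (pour s.+1 e + G)))); first lra.
  by apply: ler_wpM2l; [exact: ltW | rewrite lerD].
have -> : (a + 1) * (2 + (K - (H + (a + 1)^-1)) + d * (x + 1)) =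
   (a + 1) * (2 + (K - H) + d * x) + (a + 1) * d - 1.
  by field; rewrite gt_eqF.
move=> h2; rewrite -(ler_pM2l a1) (le_trans h2)// [leRHS]mulrCA ler_pM2l//.
lra.
Qed.

(** A single cup at time [i]: the allowance vanishes and [2 - H_1 = 1]. *)
Lemma fill_le_harmonic j : f i j <= 1 + harmonic_sum R m.
Proof.
have := @top_fills i [set j] (leqnn i); rewrite cards1 m_gt0 => /(_ isT).
rewrite big_set1 subnn mulr0 addr0 mul1r {2}/harmonic_sum big_ord_recr big_ord0/=.
by rewrite invr1; lra.
Qed.

End TopFills.

End Trajectory.

(** * Crossings under a uniform initial fill *)

Lemma uniform_prob01_itv (R : realType) (b1 b2 : bool) (a b : R) :
  0 <= a -> a <= b -> b <= 1 ->
  uniform_prob (@ltr01 R) [set` Interval (BSide b1 a) (BSide b2 b)] = (b - a)%:E.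
Proof.
move=> a0 ab b1'; rewrite /uniform_prob.
rewrite (eq_integral (fun=> 1%E)); last first.
  move=> x; rewrite inE/= in_itv/= => xab; rewrite /uniform_pdf.
  have /andP[ax xb] : a <= x <= b.
    by case/andP: xab => /lteifW -> /lteifW ->.
  by rewrite (le_trans a0 ax) (le_trans xb b1')/= subr0 invr1.
rewrite integral_cst//= mul1e lebesgue_measure_itv/= lte_fin.
by case: ltP => // ba; rewrite (@le_anti _ _ a b) ?ab// subrr.
Qed.

(** Sliding an interval of length [y - x] over a unit range makes its integer count, up to null
    sets, take two consecutive values with mean [y - x]. Thus it is bounded by a constant [d] plus a
    Bernoulli variable of mean [p]. *)
Lemma crossings_two_valued (R : realType) (x y : R) : x <= y ->
  exists (d p : R) (A : set (measurableTypeR R)),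
    [/\ 0 <= d, 0 <= p, d + p = y - x,
        measurable A /\ uniform_prob (@ltr01 R) A = p%:E &
        forall r : R, 0 < r <= 1 -> (crossings x y r)%:~R <= d + (r \in A)%:R].
Proof.
move=> xy.
set fx := (Num.floor x)%:~R : R; set fy := (Num.floor y)%:~R : R.
have /andP[fx0 fx1] := floor_itv x; have /andP[fy0 fy1] := floor_itv y.
rewrite rmorphD/= -/fx in fx0 fx1; rewrite rmorphD/= -/fy in fy0 fy1.
have fxy : Num.floor x <= Num.floor y by exact: le_floor.
have up r k : r + y < (Num.floor y + k)%:~R + 1 ->
    (Num.floor (r + y))%:~R <= fy + k%:~R.
  rewrite -(rmorphD _ _ 1) -floor_lt_int => h; rewrite -rmorphD ler_int.
  by rewrite -ltzD1.
have lo r k : (Num.floor x + k)%:~R < r + x ->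
    fx + k%:~R <= (Num.ceil (r + x) - 1)%:~R.
  by rewrite -ceil_gt_int => h; rewrite -rmorphD ler_int lerBrDr lezD1.
have lo0 (r : R) : 0 < r -> fx <= (Num.ceil (r + x) - 1)%:~R.
  by move=> r0; have := lo r 0; rewrite !addr0 => -> //; rewrite -/fx; lra.
have up1 r : r <= 1 -> (Num.floor (r + y))%:~R <= fy + 1.
  by move=> r1; apply: (up r 1); rewrite rmorphD/= -/fy; lra.
have lo1 (r : R) : 1 - (x - fx) < r -> fx + 1 <= (Num.ceil (r + x) - 1)%:~R.
  by move=> h; apply: (lo r 1); rewrite rmorphD/= -/fx; lra.
have up0 (r : R) : r < 1 - (y - fy) -> (Num.floor (r + y))%:~R <= fy.
  by move=> h; have := up r 0; rewrite !addr0 => -> //; rewrite -/fy; lra.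
have [uv|vu] := leP (x - fx) (y - fy).
  (* The right end reaches a new integer from [r = 1 - (y - fy)] on, and the left end passes one
     after [r = 1 - (x - fx)]; in between there is one extra integer. *)
  exists (fy - fx), ((y - fy) - (x - fx)), `[1 - (y - fy), 1 - (x - fx)]%classic.
  split; [by rewrite subr_ge0 ler_int|by lra|by lra|split=> //|].
    by rewrite uniform_prob01_itv; [congr EFin; lra|lra..].
  move=> r /andP[r0 r1]; rewrite /crossings rmorphB/=.
  have [rA|/negP] := boolP (r \in _).
    by have := up1 _ r1; have := lo0 _ r0; rewrite /=; lra.
  rewrite inE/= in_itv/= => /negP; rewrite negb_and -!ltNge => /orP[h|h].
    by have := up0 _ h; have := lo0 _ r0; rewrite /=; lra.
  by have := up1 _ r1; have := lo1 _ h; rewrite /=; lra.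
have fxy1 : Num.floor x + 1 <= Num.floor y.
  rewrite lezD1 lt_neqAle fxy andbT; apply/eqP => fE.
  by move: vu; rewrite /fx /fy fE; lra.
have {fxy1} : fx + 1 <= fy by rewrite -(rmorphD _ _ 1) ler_int.
move=> fxy1.
(* Now the left end passes its integer before the right end reaches one, so the count is lower by
   one exactly in between, and [A] is the complement. *)
exists (fy - fx - 1), (1 - ((x - fx) - (y - fy))),
  (~` `]1 - (x - fx), 1 - (y - fy)[%classic).
split; [by lra|by lra|by lra|split=> //|].
- exact: measurableC.
- rewrite probability_setC// [X in (_ - X)%E]uniform_prob01_itv; [|lra..].
  by rewrite -EFinB; congr EFin; lra.
move=> r /andP[r0 r1]; rewrite /crossings rmorphB/=.
rewrite in_setC.
have [rA|/negP] := boolP (r \in _).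
  move: rA; rewrite inE/= in_itv/= => /andP[h1 h2].
  by have := up0 _ h2; have := lo1 _ h1; rewrite /=; lra.
rewrite inE/= in_itv/= => /negP; rewrite negb_and -!leNgt => /orP[h|h] /=.
  have h2 : r < 1 - (y - fy) by lra.
  by have := up0 _ h2; have := lo0 _ r0; lra.
have h2 : 1 - (x - fx) < r by lra.
by have := up1 _ r1; have := lo1 _ h2; lra.
Qed.

(** * Union bound and Chernoff bound *)

Lemma le_measure_bigsetU (R : realType) (d : measure_display)
    (T : measurableType d) (mu : {measure set T -> \bar R}) (I : Type)
    (s : seq I) (Q : pred I) (A : I -> set T) :
  (forall i, measurable (A i)) ->
  (mu (\big[setU/set0]_(i <- s | Q i) A i) <= \sum_(i <- s | Q i) mu (A i))%E.
Proof.
move=> mA; elim: s => [|i s IH]; first by rewrite !big_nil measure0.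
rewrite !big_cons; case: (Q i) => //.
have mU : measurable (\big[setU/set0]_(j <- s | Q j) A j).
  exact: bigsetU_measurable.
by rewrite (le_trans (measureU2 mu (mA i) mU))// leeD2l.
Qed.

Section Chernoff.
Context (R : realType) (d : measure_display) (T : measurableType d).
Context (P : probability T R) (n : nat) (X : 'I_n -> {RV P >-> R}).
Hypothesis indepX : mutually_independent X.
Context (A : 'I_n -> set (measurableTypeR R)) (p : 'I_n -> R).
Hypothesis mA : forall j, measurable (A j).
Hypothesis pE : forall j, P (X j @^-1` A j) = (p j)%:E.

Let mXpre j (C : set (measurableTypeR R)) :
  measurable C -> measurable (X j @^-1` C).
Proof.
move=> mC; rewrite -[X in measurable X]setTI.
exact: (measurable_funPT (X j) measurableT C mC).
Qed.

Let B (J : {set 'I_n}) j : set (measurableTypeR R) :=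
  if j \in J then A j else ~` A j.

Let mB J j : measurable (B J j).
Proof. by rewrite /B; case: ifP => // _; exact: measurableC. Qed.

(** These are the disjoint atoms generated by the success events; the number of successes is [#|J|]
    on each. *)
Let pattern (J : {set 'I_n}) : set T :=
  [set w | forall j, (X j w \in A j) = (j \in J)].

Let patternE (J : {set 'I_n}) : pattern J =
  \bigcap_(j in [set: 'I_n]) X j @^-1` B J j.
Proof.
apply/seteqP; split=> w /= h j.
  move=> _; have := h j; rewrite /B; case: (j \in J) => /= h'; first exact/set_mem.
  by move=> /mem_set; rewrite h'.
have := h j I; rewrite /B; case: (j \in J) => /= h'; first exact/mem_set.
by apply/negP => /set_mem.
Qed.

Let measurable_pattern (J : {set 'I_n}) : measurable (pattern J).
Proof.
rewrite patternE; apply: fin_bigcap_measurable => //= j _; exact: mXpre.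
Qed.

Let prob_pattern (J : {set 'I_n}) :
  P (pattern J) = (\prod_j if j \in J then p j else 1 - p j)%:E.
Proof.
have -> : pattern J = [set w | forall j, j \in [set: 'I_n]%SET -> B J j (X j w)].
  rewrite patternE; apply/seteqP; split=> w /= h j; first by move=> _; exact: h.
  by move=> _; apply: h; rewrite inE.
(* Independence is applied to the full index set, with the complement of [A j] for each failure. *)
rewrite (indepX _ (mB J)) -prodEFin; apply: eq_big => [j|j _]; first by rewrite inE.
rewrite /B; case: ifP => _; first exact: pE.
rewrite preimage_setC probability_setC ?pE//.
exact: mXpre.
Qed.

(* exponential Markov inequality, summed over the finitely many patterns of
   successes instead of integrated *)
Lemma chernoff_indep (D z th : R) : 0 <= th ->
  exists2 E : set T, measurable E &
    (forall w, z <= D + \sum_j (X j w \in A j)%:R -> E w) /\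
    (P E <= (expR (th * (D - z)) * \prod_j (1 + p j * (expR th - 1)))%:E)%E.
Proof.
move=> th0.
pose Q (J : {set 'I_n}) := z <= D + #|J|%:R.
exists (\big[setU/set0]_(J | Q J) pattern J); first exact: bigsetU_measurable.
split=> [w zw|].
  pose J := [set j | X j w \in A j]%SET.
  have QJ : Q J.
    rewrite /Q (le_trans zw)// lerD2l -sum1_card natr_sum [leRHS]big_mkcond/=.
    by apply: ler_sum => j _; rewrite inE; case: (_ \in _).
  by rewrite (bigD1 J)//=; left=> j; rewrite inE.
apply: (le_trans (le_measure_bigsetU _ _ _ measurable_pattern)).
rewrite (eq_bigr _ (fun J _ => prob_pattern J)).
rewrite sumEFin lee_fin.
have p01 j : 0 <= p j <= 1.
  have mX : measurable (X j @^-1` A j).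
    exact: mXpre.
  by rewrite -!lee_fin -pE measure_ge0 probability_le1.
have prod_ge0 (J : {set 'I_n}) : 0 <= \prod_j (if j \in J then p j else 1 - p j).
  apply: prodr_ge0 => j _; have /andP[? ?] := p01 j.
  by case: ifP => _ //; rewrite subr_ge0.
apply: (@le_trans _ _ (\sum_(J : {set 'I_n}) expR (th * (D - z)) *
    (expR th ^+ #|J| * \prod_j (if j \in J then p j else 1 - p j)))).
  rewrite [leLHS]big_mkcond; apply: ler_sum => J _; case: ifPn => [QJ|_].
    rewrite mulrA ler_peMl// -expRM_natl -expRD -[leLHS]expR0 ler_expR.
    rewrite (_ : th * (D - z) + _ = th * (D + #|J|%:R - z)); last ring.
    by rewrite mulr_ge0// subr_ge0.
  by rewrite !mulr_ge0 ?exprn_ge0 ?expR_ge0.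
rewrite -mulr_sumr ler_wpM2l ?expR_ge0// le_eqVlt; apply/orP; left; apply/eqP.
(* Expanding this product over subsets recovers the sum over patterns. *)
rewrite (eq_bigr (fun j => p j * expR th + (1 - p j))); last by move=> j _; ring.
rewrite bigA_distr/=; apply: eq_bigr => J _.
rewrite -prodr_const big_mkcond -big_split/=.
by apply: eq_bigr => j _; case: ifP => _; rewrite ?mul1r// mulrC.
Qed.

End Chernoff.

(** The constants and Bernoulli means add up to the water poured. The former contribute
    [th * d <= (expR th - 1) * d], the latter [1 + u <= expR u]. The measurable superset [E] spares
    a separate measurability argument for the tail event. *)
Lemma crossings_tail (R : realType) (d : measure_display)
    (T : measurableType d) (P : probability T R) (n : nat)
    (r : 'I_n -> {RV P >-> R}) (x y : 'I_n -> R) (z th : R) :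
  (forall j, uniform_01 (r j)) -> mutually_independent r ->
  (forall j, x j <= y j) -> 0 <= th ->
  exists2 E : set T, measurable E &
    (forall w, z <= (\sum_j crossings (x j) (y j) (r j w))%:~R -> E w) /\
    (P E <= (expR ((expR th - 1) * (\sum_j (y j - x j)) - th * z))%:E)%E.
Proof.
move=> unif indep xy th0.
have /choice[dpA dpAP] : forall j, exists dpA : R * R * set (measurableTypeR R),
    [/\ 0 <= dpA.1.1, 0 <= dpA.1.2, dpA.1.1 + dpA.1.2 = y j - x j,
        measurable dpA.2 /\ uniform_prob (@ltr01 R) dpA.2 = dpA.1.2%:E &
        forall r : R, 0 < r <= 1 ->
          (crossings (x j) (y j) r)%:~R <= dpA.1.1 + (r \in dpA.2)%:R].
  move=> j; have [d' [p [A ?]]] := crossings_two_valued (xy j).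
  by exists (d', p, A).
pose dd j := (dpA j).1.1; pose p j := (dpA j).1.2; pose A j := (dpA j).2.
have mA j : measurable (A j) by have [_ _ _ []] := dpAP j.
have pE j : P (r j @^-1` A j) = (p j)%:E.
  have [_ _ _ [_ <-] _] := dpAP j; by have [_ /(_ _ (mA j)) <-] := unif j.
have [E mE [zE PE]] := chernoff_indep indep mA pE (\sum_j dd j) z th0.
exists E => //; split=> [w zw|].
  apply: zE; apply: (le_trans zw).
  rewrite rmorph_sum -big_split/=; apply: ler_sum => j _.
  by have [_ _ _ _] := dpAP j; apply; have [+ _] := unif j; exact.
apply: (le_trans PE); rewrite lee_fin.
have e1 : th <= expR th - 1 by rewrite lerBrDl expR_ge1Dx.
have eth0 : 0 <= expR th - 1 by exact: le_trans e1.
apply: (@le_trans _ _ (expR (th * (\sum_j dd j - z)) *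
    \prod_j expR (p j * (expR th - 1)))).
  rewrite ler_wpM2l ?expR_ge0//; apply: ler_prod => j _.
  have [_ p0 _ _ _] := dpAP j.
  by rewrite expR_ge1Dx addr_ge0// mulr_ge0.
rewrite -expR_sum -expRD ler_expR -mulr_suml.
have -> : \sum_j (y j - x j) = \sum_j dd j + \sum_j p j.
  by rewrite -big_split/=; apply: eq_bigr => j _; have [_ _ <-] := dpAP j.
have : 0 <= \sum_j dd j by apply: sumr_ge0 => j _; have [] := dpAP j.
move=> D0; have := ler_wpM2r D0 e1; lra.
Qed.

(** * Geometric series and the gain per step *)

Lemma sum_geometric_le (R : realType) (q : R) (s : nat) :
  0 <= q -> q < 1 -> \sum_(t < s.+1) q ^+ (s - t) <= (1 - q)^-1.
Proof.
move=> q0 q1; have q1' : 0 < 1 - q by rewrite subr_gt0.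
elim: s => [|s IH].
  by rewrite big_ord_recr big_ord0/= add0r -[leLHS]invr1 lef_pV2 ?posrE// gerBl.
rewrite big_ord_recr/= subnn expr0.
rewrite (eq_bigr (fun t : 'I_s.+1 => q * q ^+ (s - t))); last first.
  by move=> t _; rewrite -exprS subSn// -ltnS.
rewrite -mulr_sumr (@le_trans _ _ (q * (1 - q)^-1 + 1))// ?lerD2r ?ler_wpM2l//.
by rewrite le_eqVlt; apply/orP; left; apply/eqP; field; rewrite gt_eqF.
Qed.

(* With th = eps / 2, a step adds at most (e^th - 1) (1 - eps) - th to the
   Chernoff exponent. *)
Lemma expR_half_bound (R : realType) (eps : R) : 0 < eps -> eps <= 2^-1 ->
  (expR (eps / 2) - 1) * (1 - eps) <= eps / 2 - eps ^+ 2 / 4.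
Proof.
move=> e0 e1; set th := eps / 2.
have th1 : 0 < 1 - th by rewrite /th; lra.
have : expR th <= (1 - th)^-1.
  rewrite -[expR th]invrK -expRN lef_pV2 ?posrE ?expR_gt0//.
  exact: expR_ge1Dx.
rewrite -(ler_pM2r th1) mulVf ?gt_eqF// => h.
rewrite -(ler_pM2r th1).
have : (expR th * (1 - th) - (1 - th)) * (1 - eps) <= th * (1 - eps).
  by rewrite ler_wpM2r; lra.
have : 0 <= eps ^+ 2 / 4 * th by rewrite mulr_ge0 ?divr_ge0 ?sqr_ge0// /th; lra.
rewrite /th; nra.
Qed.

(** * Union bound over all windows *)

Section Backlog.
Context (R : realType) (n : nat) (eps : R).
Context (d : measure_display) (T : measurableType d) (P : probability T R).
Context (pour : nat -> 'I_n -> R) (fill : nat -> 'I_n -> {RV P >-> R}).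
Hypotheses (eps_gt0 : 0 < eps) (eps_le : eps <= 2^-1).
Hypothesis fillerP : oblivious_filler eps pour.
Hypothesis gameP : smoothed_greedy_game pour fill.

Lemma measurable_backlog i (k : R) :
  measurable [set w | k <= backlog (fun j => fill i j w)].
Proof.
(* The event [k <= 0] accounts for the base value 0 of the maximum. *)
have -> : [set w | k <= backlog (fun j => fill i j w)] =
    [set w | k <= 0] `|` \bigcup_(j in [set: 'I_n]) [set w | k <= fill i j w].
  apply/seteqP; split=> w /=.
    by move=> /bigmax_geP[k0|[j _ kj]]; [left|right; exists j].
  by move=> [k0|[j _ kj]]; apply/bigmax_geP; [left|right; exists j].
apply: measurableU.
  have [k0|k0] := leP k 0.
    by rewrite (_ : [set _ | _] = setT)//; apply/seteqP; split.
  by rewrite (_ : [set _ | _] = set0)//; apply/seteqP; split.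
apply: fin_bigcup_measurable => //= j _.
rewrite (_ : [set _ | _] = fill i j @^-1` `[k, +oo[%classic); last first.
  by apply/seteqP; split=> w /=; rewrite in_itv/= andbT.
rewrite -[X in measurable X]setTI.
by apply: (measurable_funPT (fill i j) measurableT); exact: measurable_itv.
Qed.

Lemma poured_window t s : (t <= s)%N ->
  (forall j, poured pour t j <= poured pour s j) /\
  \sum_j (poured pour s j - poured pour t j) <= (1 - eps) * (s - t)%:R.
Proof.
move=> /subnKC <-; rewrite addKn; elim: (s - t)%N => [|L [IH1 IH2]].
  by rewrite addn0; split=> [//|]; rewrite big1 ?mulr0// => j _; rewrite subrr.
rewrite addnS; have [p0 psum] := fillerP (ltn0Sn (t + L)).
split=> [j|]; first by rewrite pouredS (le_trans (IH1 j))// lerDl.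
rewrite (eq_bigr (fun j => (poured pour (t + L) j - poured pour t j)
   + pour (t + L).+1 j)); last by move=> j _; rewrite pouredS; ring.
by rewrite big_split/= -natr1 mulrDr mulr1 lerD.
Qed.

(** The Chernoff bound at [th = eps / 2]. The allowance [eps * (i - s)] yields [eps ^+ 2 / 2] per
    step, of which half is kept so that both powers share one ratio. *)
Lemma window_tail (i m t s : nat) : (t <= s <= i)%N ->
  exists2 E : set T, measurable E &
    (forall w, m%:R + eps * (i - s)%:R <=
       (\sum_j crossings (poured pour t j) (poured pour s j) (fill 0%N j w)
         - (s - t)%:Z)%:~R -> E w) /\
    (P E <= (expR (- (eps ^+ 2 / 4)) ^+ (s - t)
             * expR (- (eps ^+ 2 / 4)) ^+ (i - s)
             * expR (- (eps * m%:R / 2)))%:E)%E.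
Proof.
move=> /andP[ts si]; have [unif indep _] := gameP.
have [mono tot] := poured_window ts.
have th0 : 0 <= eps / 2 by rewrite divr_ge0// ltW.
have [E mE [zE PE]] := crossings_tail
  (m%:R + eps * (i - s)%:R + (s - t)%:R) unif indep mono th0.
exists E => //; split=> [w|].
  by rewrite rmorphB/= lerBrDr; exact: zE.
apply: (le_trans PE); rewrite lee_fin -!expRM_natl -!expRD ler_expR.
have e1 : 0 <= expR (eps / 2) - 1 by rewrite subr_ge0 -[leLHS]expR0 ler_expR.
have := ler_wpM2l e1 tot.
have L0 : (0 : R) <= (s - t)%:R by [].
have := ler_wpM2r L0 (expR_half_bound eps_gt0 eps_le).
have : 0 <= eps ^+ 2 * (i - s)%:R by rewrite mulr_ge0 ?sqr_ge0.
set L := (s - t)%:R; set a := (i - s)%:R; set X := expR _ - 1.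
rewrite !expr2; lra.
Qed.

(** Summing over [t] and then over [s] gives two geometric series of ratio [q], each at most
    [8 / eps ^+ 2]. *)
Lemma backlog_tail (i m : nat) (k : R) : (0 < m)%N ->
  1 + harmonic_sum R m < k ->
  (P [set w | (k <= backlog (fun j => fill i j w))%R] <=
   ((8 / eps ^+ 2) ^+ 2 * expR (- (eps * m%:R / 2)))%:E)%E.
Proof.
move=> m0 Hk; have [unif _ step] := gameP.
set q := expR (- (eps ^+ 2 / 4)).
have /choice[E EP] : forall st : nat * nat, exists E : set T, measurable E /\
    ((st.2 <= st.1 <= i)%N ->
    (forall w, m%:R + eps * (i - st.1)%:R <=
       (\sum_j crossings (poured pour st.2 j) (poured pour st.1 j) (fill 0%N j w)
         - (st.1 - st.2)%:Z)%:~R -> E w) /\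
    (P E <= (q ^+ (st.1 - st.2) * q ^+ (i - st.1)
             * expR (- (eps * m%:R / 2)))%:E)%E).
  move=> [s t]; case: (boolP (t <= s <= i)%N) => [tsi|/negbTE tsi].
    by have [E mE EP] := window_tail m tsi; exists E.
  (* A pair that is not a window gets the empty event, which makes the choice total. *)
  by exists set0; split.
have mE st : measurable (E st) by have [] := EP st.
pose F (s : 'I_i.+1) := \big[setU/set0]_(t < s.+1) E (val s, val t).
have mF s : measurable (F s) by exact: bigsetU_measurable.
have mU : measurable (\big[setU/set0]_(s < i.+1) F s) by exact: bigsetU_measurable.
apply: (@le_trans _ _ (P (\big[setU/set0]_(s < i.+1) F s))).
  apply: le_measure; rewrite ?inE//; first exact: measurable_backlog.
  move=> w /= kw; apply: contrapT => nU.
  have H0 : 0 <= harmonic_sum R m by apply: sumr_ge0 => j _; rewrite invr_ge0.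
  have [j kj] : exists j, k <= fill i j w.
    move/bigmax_geP: kw => [k0|[j _ kj]]; last by exists j.
    by exfalso; move: k0 Hk; lra.
  (* Outside all the events the queue is small at every [s <= i], and the deterministic bound
     contradicts [k <= fill i j w]. *)
  suff : fill i j w <= 1 + harmonic_sum R m by move: kj Hk; lra.
  have f0 j' : 0 < fill 0%N j' w <= 1 by have [] := unif j'.
  apply: (fill_le_harmonic eps_gt0 fillerP f0 (fun i => step i w) m0) => s si.
  have [t ts q_le] := queue_bound f0 (fun i => step i w) s.
  rewrite leNgt; apply/negP => lt_q; apply: nU.
  have si' : (s < i.+1)%N by rewrite ltnS.
  have ts' : (t < s.+1)%N by rewrite ltnS.
  rewrite (bigD1 (Ordinal si'))//=; left; rewrite /F (bigD1 (Ordinal ts'))//=; left.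
  have [_] := EP (s, t); rewrite /= ts si => /(_ isT)[+ _]; apply.
  by rewrite (le_trans (ltW lt_q))// ler_int.
apply: (le_trans (le_measure_bigsetU _ _ _ mF)).
have PF (s : 'I_i.+1) : (P (F s) <= \sum_(t < s.+1)
    (q ^+ (s - t) * q ^+ (i - s) * expR (- (eps * m%:R / 2)))%:E)%E.
  apply: (le_trans (le_measure_bigsetU _ _ _ (fun t => mE (val s, val t)))).
  apply: lee_sum => t _; have [_] := EP (val s, val t).
  by rewrite /= -ltnS ltn_ord -ltnS ltn_ord => /(_ isT)[].
apply: (le_trans (lee_sum _ (fun s _ => PF s))).
under eq_bigr do rewrite sumEFin.
rewrite sumEFin lee_fin.
have e2 : 0 < eps ^+ 2 / 4 by rewrite divr_gt0// exprn_gt0.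
have q0 : 0 <= q by exact: expR_ge0.
have q1 : q < 1 by rewrite -[ltRHS]expR0 ltr_expR oppr_lt0.
have geo : (1 - q)^-1 <= 8 / eps ^+ 2.
  rewrite -[8 / _]invrK lef_pV2 ?posrE ?subr_gt0// ?invr_gt0 ?divr_gt0 ?exprn_gt0//.
  have e4 : 0 < 1 + eps ^+ 2 / 4 by lra.
  have : q <= (1 + eps ^+ 2 / 4)^-1.
    by rewrite /q expRN lef_pV2 ?posrE ?expR_gt0// expR_ge1Dx.
  have -> : (8 / eps ^+ 2)^-1 = eps ^+ 2 / 8 by rewrite invf_div.
  have : (1 + eps ^+ 2 / 4)^-1 <= 1 - eps ^+ 2 / 8.
    rewrite -(ler_pM2r e4) mulVf ?gt_eqF//.
    have : eps ^+ 2 <= 1 by apply: exprn_ile1; [exact: ltW | move: eps_le; lra].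
    set u := eps ^+ 2 in e2 *; nra.
  lra.
apply: (@le_trans _ _ (\sum_(s < i.+1) q ^+ (i - s) *
    ((1 - q)^-1 * expR (- (eps * m%:R / 2))))).
  apply: ler_sum => s _; rewrite -!mulr_suml mulrAC mulrC.
  by rewrite ler_wpM2l ?exprn_ge0// ler_wpM2r ?expR_ge0// sum_geometric_le.
rewrite -mulr_suml mulrA ler_wpM2r ?expR_ge0// expr2.
apply: ler_pM => //; first by apply: sumr_ge0 => s _; rewrite exprn_ge0.
  by rewrite invr_ge0 subr_ge0 ltW.
exact: le_trans (sum_geometric_le _ q0 q1) geo.
Qed.

End Backlog.

(** * Numerical estimates *)

Lemma powR2_bounds (R : realType) (y : R) : 0 <= y ->
  2 `^ y <= expR y /\ expR (- y) <= 2 `^ (- y).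
Proof.
move=> y0; have l2 : ln (2 : R) <= 1 by apply: (@le_ln1Dx R 1); lra.
have := ler_wpM2l y0 l2.
by rewrite /powR pnatr_eq0/= !ler_expR mulNr lerN2 mulr1.
Qed.

(** Half of the exponent absorbs the polynomial factor: raise [x / 64 <= expR (x / 64)] to the
    eighth power. *)
Lemma expR_exp8_le (R : realType) (x : R) : 0 <= x ->
  x ^+ 8 * expR (- (x / 4)) <= 64 ^+ 8 * expR (- (x / 8)).
Proof.
move=> x0.
have h : (x / 64) ^+ 8 <= expR (x / 8).
  have -> : x / 8 = 8%:R * (x / 64) by field.
  rewrite expRM_natl lerXn2r ?nnegrE ?divr_ge0 ?expR_ge0//.
  by rewrite (le_trans _ (expR_ge1Dx _))// lerDr.
have -> : - (x / 8) = x / 8 + - (x / 4) by field.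
rewrite expRD mulrA ler_wpM2r ?expR_ge0//.
by rewrite mulrC -ler_pdivrMr ?exprn_gt0// -expr_div_n.
Qed.

Lemma double_exp_tail (R : realType) (eps k : R) (m : nat) :
  0 < eps -> 5 <= k -> 3 * ln (1 / eps) <= k ->
  expR (k / 2) < m.+1%:R -> (0 < m)%N ->
  (8 / eps ^+ 2) ^+ 2 * expR (- (eps * m%:R / 2)) <=
  64 ^+ 9 * expR 2 * 2 `^ (- (2 `^ (12^-1 * k))).
Proof.
move=> e0 k5 ek mk m0.
(* In this unit [1 / eps <= x ^+ 2] and [m >= x ^+ 3 / 2], hence [eps * m >= x / 2], while [eps^-4]
   costs at most [x ^+ 8]. *)
set x := expR (k / 6).
have x0 : 0 < x by exact: expR_gt0.
have eV : eps^-1 <= x ^+ 2.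
  rewrite -[eps^-1]lnK ?posrE ?invr_gt0// -expRM_natl ler_expR.
  by move: ek; rewrite div1r; lra.
have x3 : x ^+ 3 = expR (k / 2) by rewrite -expRM_natl; congr expR; field.
have mx : x ^+ 3 <= 2 * m%:R.
  rewrite x3 (le_trans (ltW mk))// -natrM ler_nat; lia.
have emx : x <= 2 * (eps * m%:R).
  have h : x ^+ 3 * eps <= 2 * m%:R * eps by rewrite ler_wpM2r// ltW.
  have xe : 1 <= x ^+ 2 * eps by rewrite -ler_pdivrMr// mul1r.
  have := ler_wpM2l (ltW x0) xe; lra.
apply: (@le_trans _ _ (64 ^+ 9 * expR (- (x / 8)))).
  apply: (@le_trans _ _ (64 * (x ^+ 8 * expR (- (x / 4))))); last first.
    by rewrite [64 ^+ 9]exprS -mulrA ler_wpM2l// expR_exp8_le// ltW.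
  rewrite mulrA; apply: ler_pM; rewrite ?sqr_ge0 ?expR_ge0//; last first.
    by rewrite ler_expR lerN2; lra.
  have -> : 64 * x ^+ 8 = (8 * (x ^+ 2) ^+ 2) ^+ 2 by ring.
  apply: lerXn2r; first by rewrite nnegrE divr_ge0 ?sqr_ge0.
    by rewrite nnegrE mulr_ge0 ?sqr_ge0.
  rewrite -exprVn ler_wpM2l//; apply: lerXn2r => //.
    by rewrite nnegrE invr_ge0 ltW.
  by rewrite nnegrE sqr_ge0.
rewrite -mulrA ler_wpM2l ?exprn_ge0//.
set y := 2 `^ _; set v := expR (12^-1 * k).
have k12 : 0 <= 12^-1 * k by lra.
have [yv _] := powR2_bounds k12; have [_ ty] := powR2_bounds (powR_ge0 2 (12^-1 * k)).
apply: (@le_trans _ _ (expR 2 * expR (- v))); last first.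
  by rewrite ler_wpM2l ?expR_ge0// (le_trans _ ty)// ler_expR lerN2.
rewrite -expRD ler_expR.
have -> : x = v ^+ 2 by rewrite /v -expRM_natl; congr expR; field.
(* The square gives [v - 2 <= v ^+ 2 / 8]; the 2 is the source of the factor [expR 2]. *)
have := sqr_ge0 (v - 4); rewrite !expr2; lra.
Qed.

(** * Choice of the constants and of the queue length *)

Theorem theorem4p1 (R : realType) :
  exists C c : R, 0 < C /\ 0 < c /\
    forall (n : nat) (eps : R), (1 <= n)%N -> 0 < eps -> eps <= 2^-1 ->
    forall (d : measure_display) (T : measurableType d) (P : probability T R)
      (pour : nat -> 'I_n -> R) (fill : nat -> 'I_n -> {RV P >-> R}),
      oblivious_filler eps pour ->
      smoothed_greedy_game pour fill ->
      forall (i : nat) (k : R), 0 <= k -> 3 * ln (1 / eps) <= k ->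
        (P [set w | (k <= backlog (fun j => fill i j w))%R]
           <= (C * 2 `^ (- (2 `^ (c * k))))%:E)%E.
Proof.
exists (64 ^+ 9 * expR 2), 12^-1; split; first by rewrite mulr_gt0 ?exprn_gt0 ?expR_gt0.
split=> // n eps _ e0 e1 d T P pour fill fillerP gameP i k k0 ek.
(* For [k < 5] the double exponential is at least [1 / 4], so the constant makes the bound exceed
   1. *)
have [k5|k5] := leP 5 k; last first.
  apply: (le_trans (probability_le1 _ (measurable_backlog fill i k))).
  rewrite lee_fin.
  have : 2 `^ (12^-1 * k) <= 2 `^ 1 :> R by rewrite ler_powR ?ler1n//; lra.
  rewrite powRr1// => p2.
  have : 2 `^ (-2) <= 2 `^ (- 2 `^ (12^-1 * k)) :> R.
    by rewrite ler_powR ?ler1n// lerN2.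
  rewrite [2 `^ (-2)]powRN -[X in _ `^ X]/(2%:R) powR_mulrn// => t4.
  have e2 : 1 <= expR 2 :> R by rewrite -[leLHS]expR0 ler_expR.
  have K : 64 <= 64 ^+ 9 :> R by rewrite ler_eXnr// ler1n.
  have : 64 <= 64 ^+ 9 * expR 2 :> R by rewrite (le_trans K)// ler_peMr.
  move: t4; set t := 2 `^ _; set C := _ * expR 2.
  have -> : (2 ^+ 2)^-1 = 4^-1 :> R by field.
  by nra.
(* This gives [1 + H_m <= 2 + k / 2], which is below [k] as [k >= 5]. *)
set m := Num.truncn (expR (k / 2)).
have /andP[mle mlt] := truncn_itv (expR_ge0 (k / 2)).
have m0 : (0 < m)%N by rewrite truncn_gt0 -[leLHS]expR0 ler_expR; lra.
have Hk : 1 + harmonic_sum R m < k.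
  have := harmonic_sum_le_ln R m0.
  have : ln m%:R <= k / 2 by rewrite -[leRHS]expRK ler_ln ?posrE ?ltr0n ?expR_gt0.
  lra.
apply: (le_trans (backlog_tail e0 e1 fillerP gameP i m0 Hk)).
by rewrite lee_fin double_exp_tail.
Qed.
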